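(* Let $T=(t_i)_{i\le n}$, $t_i=(x_i,y_i)$, be an Erdős–Szekeres tableau. Define a relation $R$ on $[n]$ by: $i\,R\,j$ whenever $t_i$ hooks $t_j$, and $j\,R\,i$ whenever $t_i$ slices $t_j$. Then the strict order $<_{P(T)}$ of the order poset equals the transitive closure of $R$.
   Context: For a sequence $A=(a_1,\dots,a_n)$ of distinct real numbers, $a_i^+$ (resp. $a_i^-$) is the length of the longest increasing (resp. decreasing) subsequence of $A$ ending at $a_i$; the EST of $A$ is $T(A)=((a_i^+,a_i^-))_{i\le n}$. For $m\le n$, $T_m=(t_1,\dots,t_m)$, regarded also as a set of points. For a point $(x,y)$: $\mathrm{Col}(x,y)=\{(x,y'): y'>y\}$ and $\mathrm{Row}(x,y)=\{(x',y): x'>x\}$. For $i<j$: $t_i$ hooks $t_j$ if there is an integer $x$ with $x_i\le x\le x_j$ and $\mathrm{Col}(x,y_i)\cap T_j=\emptyset$; $t_i$ slices $t_j$ if there is an integer $y$ with $y_i\le y\le y_j$ and $\mathrm{Row}(x_i,y)\cap T_j=\emptyset$. A sequence $A$ is identified with the linear order $i<_A j$ iff $a_i<a_j$ on $[n]$; $[T]$ is the set of such orders with $T(A)=T$; the order poset $P(T)$ on $[n]$ has $i<_{P(T)}j$ iff $i<_A j$ for all $A\in[T]$. *)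

(* Defs.v *)
From HB Require Import structures.
From Stdlib Require Import Relation_Operators.
From mathcomp Require Import all_boot all_order all_algebra.
From mathcomp Require Import boolp classical_sets reals.

Set Implicit Arguments.
Unset Strict Implicit.
Unset Printing Implicit Defensive.

Import Order.TTheory GRing.Theory Num.Theory.
Local Open Scope classical_set_scope.
Local Open Scope ring_scope.

(* Positions are numbered from 0: the i-th term of a sequence of length n is
   its value at i : 'I_n. A subsequence is given by its set of positions. *)

Definition increasing_on (R : realType) (n : nat) (A : 'I_n -> R)
    (S : {set 'I_n}) : bool :=
  [forall j in S, forall k in S, (j < k)%N ==> (A j < A k)].

Definition decreasing_on (R : realType) (n : nat) (A : 'I_n -> R)
    (S : {set 'I_n}) : bool :=
  [forall j in S, forall k in S, (j < k)%N ==> (A k < A j)].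

Definition ends_at (n : nat) (i : 'I_n) (S : {set 'I_n}) : bool :=
  (i \in S) && [forall k in S, (k <= i)%N].

Definition inc_length (R : realType) (n : nat) (A : 'I_n -> R) (i : 'I_n)
    : nat :=
  (\max_(S : {set 'I_n} | ends_at i S && increasing_on A S) #|S|)%N.

Definition dec_length (R : realType) (n : nat) (A : 'I_n -> R) (i : 'I_n)
    : nat :=
  (\max_(S : {set 'I_n} | ends_at i S && decreasing_on A S) #|S|)%N.

Definition est (R : realType) (n : nat) (A : 'I_n -> R)
    : {ffun 'I_n -> nat * nat} :=
  [ffun i => (inc_length A i, dec_length A i)].

Definition is_est (R : realType) (n : nat) (T : {ffun 'I_n -> nat * nat})
    : Prop :=
  exists2 A : 'I_n -> R, injective A & est A = T.

(* The points t_k with k <= j, t_j included. *)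
Definition initial (n : nat) (T : {ffun 'I_n -> nat * nat}) (j : 'I_n)
    : set (nat * nat) :=
  [set T k | k in [set k : 'I_n | (k <= j)%N]].

Definition Col (x y : nat) : set (nat * nat) :=
  [set p | p.1 = x /\ (y < p.2)%N].

Definition Row (x y : nat) : set (nat * nat) :=
  [set p | (x < p.1)%N /\ p.2 = y].

(* The integers x and y below lie between coordinates of points, which are
   natural numbers, so ranging over nat loses nothing. *)
Definition hooks (n : nat) (T : {ffun 'I_n -> nat * nat}) (i j : 'I_n)
    : Prop :=
  (i < j)%N /\
  exists x : nat, ((T i).1 <= x <= (T j).1)%N /\
    Col x (T i).2 `&` initial T j = set0.

Definition slices (n : nat) (T : {ffun 'I_n -> nat * nat}) (i j : 'I_n)
    : Prop :=
  (i < j)%N /\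
  exists y : nat, ((T i).2 <= y <= (T j).2)%N /\
    Row (T i).1 y `&` initial T j = set0.

Definition hook_slice (n : nat) (T : {ffun 'I_n -> nat * nat}) (i j : 'I_n)
    : Prop :=
  hooks T i j \/ slices T j i.

Definition seq_order (R : realType) (n : nat) (A : 'I_n -> R) : rel 'I_n :=
  fun i j => A i < A j.

Definition est_orders (R : realType) (n : nat)
    (T : {ffun 'I_n -> nat * nat}) : set (rel 'I_n) :=
  [set seq_order A | A in [set A : 'I_n -> R | injective A /\ est A = T]].

Definition order_poset_lt (R : realType) (n : nat)
    (T : {ffun 'I_n -> nat * nat}) (i j : 'I_n) : Prop :=
  forall L : rel 'I_n, est_orders R T L -> L i j.

(* Main.v *)
Require Import Defs.
From Stdlib Require Import Relation_Operators.
From mathcomp Require Import all_boot all_order all_algebra.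
From mathcomp Require Import boolp classical_sets reals.
From mathcomp Require Import zify.

(** Hooking forces [a_i < a_j] and slicing forces [a_j < a_i] in every sequence
    with tableau [T].  Conversely every linear order extending the relation has
    tableau [T]: if [i < j] and [x_j <= x_i], then [t_i] slices [t_j] in the
    row [y_j]; and if [x_j > 1], then the highest point of the column [x_j - 1]
    before [t_j] hooks [t_j]; these facts and their mirror images determine the
    tableau.  As the transitive closure is a strict partial order, any pair it
    leaves unrelated can be put in either order by a linear extension. *)

Import Order.TTheory GRing.Theory Num.Theory.
Local Open Scope ring_scope.

(** These local conditions determine the lengths of longest increasing subsequences, so maxima over
    subsets are handled only once. Decreasing lengths are covered by passing to [- A]. *)
Definition is_rank {R : realType} {n : nat} (A : 'I_n -> R) (x : 'I_n -> nat)
    : Prop :=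
  [/\ forall j, (0 < x j)%N,
      forall i j : 'I_n, (i < j)%N -> A i < A j -> (x i < x j)%N
    & forall j, (1 < x j)%N ->
        exists i : 'I_n, [/\ (i < j)%N, A i < A j & (x i).+1 = x j]].

(* [col_gap x y] is hooking and [col_gap y x] is slicing. *)
Definition col_gap {n : nat} (x y : 'I_n -> nat) (i j : 'I_n) : Prop :=
  (i < j)%N /\ exists c : nat, (x i <= c <= x j)%N /\
    forall k : 'I_n, (k <= j)%N -> x k = c -> (y k <= y i)%N.

(** * Lengths of longest monotone subsequences as ranks *)

Lemma increasing_onP {R : realType} {n : nat} {A : 'I_n -> R}
    {S : {set 'I_n}} :
  reflect (forall j k, j \in S -> k \in S -> (j < k)%N -> A j < A k)
    (increasing_on A S).
Proof.
apply: (iffP forall_inP) => [h j k jS kS jk|h j jS].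
  by have /forall_inP /(_ k kS) /implyP := h j jS; apply.
by apply/forall_inP => k kS; apply/implyP; apply: h.
Qed.

Lemma ends_atP {n : nat} {i : 'I_n} {S : {set 'I_n}} :
  reflect (i \in S /\ forall k : 'I_n, k \in S -> (k <= i)%N) (ends_at i S).
Proof. by apply: (iffP andP) => -[iS /forall_inP]. Qed.

Lemma inc_length_ge {R : realType} {n : nat} {A : 'I_n -> R} {i : 'I_n}
    {S : {set 'I_n}} :
  ends_at i S -> increasing_on A S -> (#|S| <= inc_length A i)%N.
Proof.
move=> iS incS; rewrite /inc_length.
by apply: (@leq_bigmax_cond _ _ (fun S : {set 'I_n} => #|S|)); rewrite iS incS.
Qed.

Lemma inc_length_attained {R : realType} {n : nat} (A : 'I_n -> R) (i : 'I_n) :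
  exists S : {set 'I_n},
    [/\ ends_at i S, increasing_on A S & #|S| = inc_length A i].
Proof.
have ex : (0 < #|[pred S : {set 'I_n} | ends_at i S && increasing_on A S]|)%N.
  apply/card_gt0P; exists [set i]; rewrite inE; apply/andP; split.
    by apply/ends_atP; split=> [|k]; rewrite inE // => /eqP ->.
  by apply/increasing_onP => j k; rewrite !inE => /eqP -> /eqP ->; rewrite ltnn.
have [S /andP[iS incS] E] := eq_bigmax_cond (fun S : {set 'I_n} => #|S|) ex.
by exists S; split=> //; rewrite -E.
Qed.

Lemma inc_length_rank {R : realType} {n : nat} (A : 'I_n -> R) :
  is_rank A (inc_length A).
Proof.
have mono (i j : 'I_n) : (i < j)%N -> A i < A j ->
    (inc_length A i < inc_length A j)%N.
  (* Appending [j] to an optimal set for [i] gives an increasing set ending at [j]. *)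
  move=> ij Aij; have [S [/ends_atP[iS Si] /increasing_onP incS <-]] :=
    inc_length_attained A i.
  have jS : j \notin S by apply/negP => /Si; lia.
  have -> : #|S|.+1 = #|j |: S| by rewrite cardsU1 jS.
  apply: inc_length_ge.
    apply/ends_atP; rewrite setU11; split=> // k /setU1P[->//|/Si]; lia.
  have top k : k \in S -> A k < A j.
    move=> kS; have := Si _ kS; rewrite leq_eqVlt => /orP[/eqP/val_inj -> //|ki].
    exact: lt_trans (incS _ _ kS iS ki) Aij.
  apply/increasing_onP => k l /setU1P[->|kS] /setU1P[->|lS].
  - by rewrite ltnn.
  - by have := Si _ lS; lia.
  - by move=> _; apply: top.
  - exact: incS.
split=> // [j|j]; have [S [/ends_atP[jS Sj] /increasing_onP incS cS]] :=
    inc_length_attained A j.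
  by rewrite -cS; apply/card_gt0P; exists j.
have cD : inc_length A j = #|S :\ j|.+1 by rewrite -cS (cardsD1 j) jS.
rewrite cD ltnS => /card_gt0P[k0 k0S].
(* The last position [i] of [S] before [j] is the predecessor: [S] without [j] is increasing and
   ends at [i], which bounds the length at [i] from below; [mono] bounds it from above. *)
have [i iS imax] := @arg_maxnP _ k0 (mem (S :\ j)) (@nat_of_ord n) k0S.
have [ij iS'] : i != j /\ i \in S by apply/andP; rewrite -in_setD1.
have lt_ij : (i < j)%N by rewrite ltn_neqAle ij Sj.
have Aij := incS _ _ iS' jS lt_ij.
exists i; split=> //; apply/eqP; rewrite eqn_leq -{1}cD mono //=.
rewrite ltnS; apply: inc_length_ge; first by apply/ends_atP.
by apply/increasing_onP => k l /setD1P[_ kS] /setD1P[_ lS]; apply: incS.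
Qed.

Lemma dec_lengthE {R : realType} {n : nat} (A : 'I_n -> R) :
  dec_length A = inc_length (fun i => - A i).
Proof.
apply/funext => i; apply: eq_bigl => S; congr (_ && _).
apply: eq_forallb => j; congr (_ ==> _); apply: eq_forallb => k.
by rewrite ltrN2.
Qed.

(** Along a chain of predecessors for [x], the value of [x] falls by exactly one and that of [x'] by
    at least one, while [x'] stays positive. *)
Lemma rank_le {R : realType} {n : nat} {A : 'I_n -> R} {x x' : 'I_n -> nat} :
  is_rank A x -> is_rank A x' -> forall j, (x j <= x' j)%N.
Proof.
move=> [_ _ pred_x] [pos' mono' _] j.
have [m] := ubnP (nat_of_ord j); elim: m j => // m IH j jm.
case: (ltnP 1 (x j)) => [/pred_x[i [ij Aij <-]]|/leq_trans]; last exact.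
by apply: leq_ltn_trans (mono' _ _ ij Aij); apply: IH; lia.
Qed.

Lemma rank_unique {R : realType} {n : nat} {A : 'I_n -> R}
    {x x' : 'I_n -> nat} : is_rank A x -> is_rank A x' -> x = x'.
Proof.
by move=> rx rx'; apply/funext => j; apply/eqP;
  rewrite eqn_leq (rank_le rx rx') (rank_le rx' rx).
Qed.

Lemma rank_est {R : realType} {n : nat} {A : 'I_n -> R}
    {T : {ffun 'I_n -> nat * nat}} :
  est A = T <-> is_rank A (fun i => (T i).1) /\
                is_rank (fun i => - A i) (fun i => (T i).2).
Proof.
split=> [<-|[rx ry]].
  split; [have := inc_length_rank A|have := inc_length_rank (fun i => - A i)];
    rewrite -?dec_lengthE; congr is_rank; apply/funext => i; by rewrite ffunE.
apply/ffunP => i; rewrite ffunE dec_lengthE.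
rewrite -(rank_unique rx (inc_length_rank A)).
by rewrite -(rank_unique ry (inc_length_rank _)) -surjective_pairing.
Qed.

(** * Column gaps and the orders respecting them *)

Lemma rank_descend {R : realType} {n : nat} {A : 'I_n -> R} {x : 'I_n -> nat} :
  is_rank A x -> forall (c : nat) (j : 'I_n), (0 < c <= x j)%N ->
  exists k : 'I_n, [/\ (k <= j)%N, A k <= A j & x k = c].
Proof.
move=> [_ _ pred_x] c j; have [m] := ubnP (nat_of_ord j).
elim: m j => // m IH j jm /andP[c0]; rewrite leq_eqVlt => /orP[/eqP ->|cx].
  by exists j.
(* Ranks drop by exactly one at each predecessor, so no value is skipped. *)
have [i [ij Aij xi]] := pred_x j (leq_ltn_trans c0 cx).
have [||k [ki Aki xk]] := IH i; [lia|lia|].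
by exists k; split=> //; [lia|exact: le_trans Aki (ltW Aij)].
Qed.

Lemma col_gap_lt {R : realType} {n : nat} {A : 'I_n -> R}
    {x y : 'I_n -> nat} {i j : 'I_n} :
  injective A -> is_rank A x -> is_rank (fun i => - A i) y ->
  col_gap x y i j -> A i < A j.
Proof.
move=> Ainj rx [_ mono_y _] [ij [c [/andP[ic cj] gap]]].
have [x_pos mono_x _] := rx.
rewrite ltNge le_eqVlt; apply/negP => /orP[/eqP/Ainj E|Aji].
  by rewrite E ltnn in ij.
(* The chain back from [j] meets column [c] at some [k] with [A k < A i]. If [k] precedes [i], then
   [x k < x i <= c]; if it follows [i], then [y i < y k] contradicts the gap. *)
have [|k [kj Akj xk]] := rank_descend rx c j; first by have := x_pos i; lia.
have Aki := le_lt_trans Akj Aji.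
case: (ltngtP k i) => [ki|ik|/val_inj E].
- by have := mono_x _ _ ki Aki; lia.
- have := mono_y _ _ ik; rewrite ltrN2 => /(_ Aki).
  by have := gap _ kj xk; lia.
- by rewrite E ltxx in Aki.
Qed.

Lemma extension_rank {R : realType} {n : nat} {A B : 'I_n -> R}
    {x y : 'I_n -> nat} :
  injective B -> is_rank B x -> is_rank (fun i => - B i) y ->
  (forall i j, col_gap x y i j -> A i < A j) ->
  (forall i j, col_gap y x i j -> A j < A i) ->
  is_rank A x.
Proof.
move=> Binj [x_pos mono_x pred_x] [_ mono_y _] hook slice.
(* A consequence of [B] that mentions only the tableau, and so can be used with [A]. *)
have desc (i j : 'I_n) : (i < j)%N -> (x j <= x i)%N -> (y i < y j)%N.
  move=> ij xji; apply: mono_y => //; rewrite ltrN2 ltNge le_eqVlt.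
  apply/negP => /orP[/eqP/Binj E|/(mono_x _ _ ij)]; last lia.
  by rewrite E ltnn in ij.
split=> // [i j ij Aij|j /pred_x[i0 [i0j _ xi0]]].
  rewrite ltnNge; apply/negP => xji.
  suff /slice : col_gap y x i j by rewrite ltNge (ltW Aij).
  (* By [desc], earlier points of the row [y j] lie strictly left of [x j], so none lies right of
     [x i]. *)
  split=> //; exists (y j); rewrite leqnn andbT (ltnW (desc _ _ ij xji)).
  split=> // k; rewrite leq_eqVlt => /orP[/eqP/val_inj -> //|kj] yk.
  rewrite leqNgt; apply/negP => xik.
  by have := desc _ _ kj; lia.
(* The predecessor [i0] under [B] only shows that this column is occupied before [j]; the
   predecessor under [A] is its highest point. *)
pose S := [pred i : 'I_n | (i < j)%N && ((x i).+1 == x j)].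
have i0S : S i0 by rewrite /= i0j xi0 eqxx.
have [i /andP[ij /eqP xi] imax] := @arg_maxnP _ i0 S y i0S.
exists i; split=> //; apply: hook; split=> //; exists (x i); split; first by lia.
move=> k kj xk; apply: imax; rewrite /= xk xi eqxx andbT ltn_neqAle kj andbT.
by apply/eqP => /val_inj E; rewrite E in xk; lia.
Qed.

(** * Hooks and slices of tableaux *)

Lemma hooks_col_gap {n : nat} {T : {ffun 'I_n -> nat * nat}} {i j : 'I_n} :
  hooks T i j <-> col_gap (fun k => (T k).1) (fun k => (T k).2) i j.
Proof.
split=> -[ij [c [ic gap]]]; split=> //; exists c; split=> //.
  move=> k kj xk; rewrite leqNgt; apply/negP => yik.
  suff : set0 (T k) by [].
  by rewrite -gap; split=> //; exists k.
apply/seteqP; split=> // p [[/= xp yp] [k kj E]].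
by rewrite -E in xp yp; have := gap k kj xp; lia.
Qed.

Lemma slices_col_gap {n : nat} {T : {ffun 'I_n -> nat * nat}} {i j : 'I_n} :
  slices T i j <-> col_gap (fun k => (T k).2) (fun k => (T k).1) i j.
Proof.
split=> -[ij [c [ic gap]]]; split=> //; exists c; split=> //.
  move=> k kj xk; rewrite leqNgt; apply/negP => yik.
  suff : set0 (T k) by [].
  by rewrite -gap; split=> //; exists k.
apply/seteqP; split=> // p [[/= xp yp] [k kj E]].
by rewrite -E in xp yp; have := gap k kj yp; lia.
Qed.

Lemma hook_slice_lt {R : realType} {n : nat} {A : 'I_n -> R}
    {T : {ffun 'I_n -> nat * nat}} {i j : 'I_n} :
  injective A -> est A = T -> hook_slice T i j -> A i < A j.
Proof.
move=> Ainj /rank_est[rx ry] [/hooks_col_gap|/slices_col_gap].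
  exact: col_gap_lt.
move=> gap; rewrite -ltrN2.
apply: (col_gap_lt (A := fun k => - A k) _ ry _ gap).
  by move=> k l /oppr_inj /Ainj.
by rewrite (_ : (fun _ => _) = A) //; apply/funext => k; rewrite opprK.
Qed.

Lemma extension_est {R : realType} {n : nat} {A : 'I_n -> R}
    {T : {ffun 'I_n -> nat * nat}} :
  is_est R T -> (forall i j, hook_slice T i j -> A i < A j) -> est A = T.
Proof.
move=> [B Binj /rank_est[rx ry]] ext; apply/rank_est; split.
  apply: (extension_rank Binj rx ry) => i j gap; apply: ext.
    by left; apply/hooks_col_gap.
  by right; apply/slices_col_gap.
(* Negating the sequences swaps the coordinates, and with them hooks and slices. *)
apply: (extension_rank (B := fun k => - B k) (y := fun k => (T k).1) _ ry).
- by move=> k l /oppr_inj /Binj.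
- by rewrite (_ : (fun _ => _) = B) //; apply/funext => k; rewrite opprK.
- by move=> i j gap; rewrite ltrN2; apply: ext; right; apply/slices_col_gap.
- by move=> i j gap; rewrite ltrN2; apply: ext; left; apply/hooks_col_gap.
Qed.

(** * Linear extensions *)

Lemma linear_extension (R : realType) {n : nat} (Q : 'I_n -> 'I_n -> Prop) :
  (forall k, ~ Q k k) -> (forall k l m, Q k l -> Q l m -> Q k m) ->
  exists2 A : 'I_n -> R, injective A & forall k l, Q k l -> A k < A l.
Proof.
move=> irr trans.
(* The size of the down-set is strictly monotone; the index breaks ties. *)
pose down (k : 'I_n) := #|[set l : 'I_n | `[< Q l k >]]|.
pose rk (k : 'I_n) := (down k * n + k)%N.
exists (fun k => (rk k)%:R) => [k l /eqP|k l Qkl].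
  (* Reduction modulo [n] recovers the index from [rk]. *)
  rewrite eqr_nat => /eqP /(congr1 (modn^~ n)).
  by rewrite !modnMDl !modn_small // => /val_inj.
rewrite ltr_nat /rk.
suff : (down k < down l)%N by have := ltn_ord k; nia.
apply: proper_card; apply/properP; split.
  by apply/fintype.subsetP => m; rewrite !finset.in_set => /asboolP Qmk;
    apply/asboolP; exact: trans _ _ _ Qmk Qkl.
by exists k; rewrite finset.in_set; [apply/asboolP|apply/asboolPn; apply: irr].
Qed.

Lemma reversing_extension (R : realType) {n : nat} (P : 'I_n -> 'I_n -> Prop)
    (i j : 'I_n) :
  (forall k, ~ P k k) -> (forall k l m, P k l -> P l m -> P k m) ->
  i <> j -> ~ P i j ->
  exists A : 'I_n -> R,
    [/\ injective A, forall k l, P k l -> A k < A l & A j < A i].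
Proof.
move=> irr trans ij nPij.
(* The transitive closure of [P] with the pair [(j, i)] added. *)
pose Q k l := P k l \/ (k = j \/ P k j) /\ (l = i \/ P i l).
(* A point weakly below [j] and weakly above [i] would create a cycle through the new pair. *)
have cross k : (k = j \/ P k j) -> (k = i \/ P i k) -> False.
  move=> [->|Pkj] [E|Pik].
  - exact/ij/esym.
  - exact: nPij.
  - by apply: nPij; rewrite -E.
  - by apply: nPij; exact: trans _ _ _ Pik Pkj.
have [||A Ainj ext] := @linear_extension R n Q.
- by move=> k [/irr //|[/cross]].
- move=> k l m [Pkl|[kj il]] [Plm|[lj im]].
  + by left; exact: trans _ _ _ Pkl Plm.
  + right; split=> //; right.
    by case: lj => [<- //|Plj]; exact: trans _ _ _ Pkl Plj.
  + right; split=> //; right.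
    by case: il => [<- //|Pil]; exact: trans _ _ _ Pil Plm.
  + by case: (cross l).
exists A; split=> // [k l Pkl|]; apply: ext; first by left.
by right; split; left.
Qed.

Theorem theorem4 (R : realType) (n : nat) (T : {ffun 'I_n -> nat * nat})
    (hT : is_est R T) (i j : 'I_n) :
  order_poset_lt R T i j <-> clos_trans 'I_n (hook_slice T) i j.
Proof.
have sound (A : 'I_n -> R) k l : injective A -> est A = T ->
    clos_trans 'I_n (hook_slice T) k l -> A k < A l.
  move=> Ainj eA; elim=> [k' l'|k' l' m _ h1 _ h2]; first exact: hook_slice_lt.
  exact: lt_trans h1 h2.
split=> [Pij|Cij L [A [Ainj eA] <-]]; last exact: sound.
have [B Binj eB] := hT.
have below (A : 'I_n -> R) : injective A -> est A = T -> A i < A j.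
  by move=> Ainj eA; apply: (Pij (seq_order A)); exists A.
apply: contrapT => nC.
have [||||A [Ainj ext Aji]] :=
  @reversing_extension R n (clos_trans 'I_n (hook_slice T)) i j => //.
(* The realization [B] rules out cycles in the closure. *)
- by move=> k /(sound B k k Binj eB); rewrite ltxx.
- by move=> k l m; apply: t_trans.
- by move=> E; have := below B Binj eB; rewrite E ltxx.
have eA : est A = T by apply: extension_est => // k l h; apply/ext/t_step.
by have := lt_trans Aji (below A Ainj eA); rewrite ltxx.
Qed.
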